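(* For every positive integer $k$, there exists $a_k\in(0,1)$ such that the functions on $\mathbb{R}$ given by \[ x_1(\theta)=\cdots=x_k(\theta)=\sqrt{\frac{1-z(\theta)^2}{k}},\qquad z(\theta)=a_k\sin\big((k+1)\theta\big) \] satisfy all of the following: \begin{itemize} \item[(i)] $x_1,\ldots,x_k\in C^1(\mathbb{R})$ are $\frac{\pi}{k+1}$-periodic, and $z\in C^1(\mathbb{R})$ is $\frac{\pi}{k+1}$-antiperiodic; \item[(ii)] $\sum_{j=1}^kx_j(\theta)^2+z(\theta)^2=1$ for every $\theta\in\mathbb{R}$; \item[(iii)] for each $j\in\{1,\ldots,k\}$, \[ \int_0^{2\pi}\bigg(x_j(\theta)^2-\frac{2}{2k+1}\bigg)\sqrt{\sum_{\ell=1}^k\big(x_\ell'(\theta)^2+\ell^2x_\ell(\theta)^2\big)+z'(\theta)^2}\,d\theta=0. \] \end{itemize} In particular, such $a_k$ exist with \[ a_1^2\in(0.820,0.821)\qquad\text{and}\qquad a_k^2\in\Big(\frac1k-\frac{1}{2k^3},\ \frac1k+\frac{1}{4k^3}\Big)\quad\text{for all }k\ge 2. \]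
   Context: A function $f\colon\mathbb{R}\to\mathbb{R}$ is $p$-antiperiodic if $f(x+p)=-f(x)$ for all $x\in\mathbb{R}$. *)

(* Defs.v *)
From Stdlib Require Import Reals.
From Coquelicot Require Import Coquelicot.
Open Scope R_scope.

Definition periodic (p : R) (f : R -> R) : Prop :=
  forall x : R, f (x + p) = f x.

Definition antiperiodic (p : R) (f : R -> R) : Prop :=
  forall x : R, f (x + p) = - f x.

(* Differentiability is required separately: [Derive] is total, with an
   unspecified value where the derivative does not exist. *)
Definition C1 (f : R -> R) : Prop :=
  forall x : R, ex_derive f x /\ continuous (Derive f) x.

Definition zfun (k : nat) (a : R) (theta : R) : R :=
  a * sin (INR (k + 1) * theta).

(* Only the indices 1 <= j <= k are meaningful; the k components coincide. *)
Definition xfun (k : nat) (a : R) (j : nat) (theta : R) : R :=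
  sqrt ((1 - zfun k a theta ^ 2) / INR k).

Definition density (k : nat) (x : nat -> R -> R) (z : R -> R) (theta : R) : R :=
  sqrt (sum_n_m (fun l : nat =>
                   Derive (x l) theta ^ 2 + INR l ^ 2 * x l theta ^ 2) 1 k
        + Derive z theta ^ 2).

Definition curve_conditions (k : nat) (x : nat -> R -> R) (z : R -> R) : Prop :=
  ((forall j : nat, (1 <= j <= k)%nat ->
      C1 (x j) /\ periodic (PI / INR (k + 1)) (x j))
   /\ C1 z /\ antiperiodic (PI / INR (k + 1)) z)
  /\ (forall theta : R,
        sum_n_m (fun j : nat => x j theta ^ 2) 1 k + z theta ^ 2 = 1)
  /\ (forall j : nat, (1 <= j <= k)%nat ->
        is_RInt (fun theta : R =>
                   (x j theta ^ 2 - 2 / (2 * INR k + 1)) * density k x z theta)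
                0 (2 * PI) 0).

(* Main.v *)
(** Write u = sin((k+1)theta)^2, A = a^2 and m = 1/(2k+1). The density is
    (k+1) sqrt V with V = A(1-u)/(1-Au) + (2k+1)(1-Au)/(6(k+1)), so condition
    (iii) says that the integral [balance k A] of (m - Au) sqrt V vanishes.
    This integral is continuous in A, so it suffices that it is positive at
    the lower and negative at the upper end of the stated range for A.
    For these signs, sqrt V is replaced by a polynomial P in u, with a uniform
    error that is small compared with the value of the integral; the moments
    of u are rational multiples of 2 pi. For k = 1, P is a numerical minimax
    polynomial of degree 19. For k >= 2, P is a Taylor polynomial of
    sqrt (3V) in h = 1/k, with an adjusted h^3 term and error h^2/4. In both
    cases (P-d)^2 <= V <= (P+d)^2, after scaling V, is a polynomial inequality
    on an interval or a rectangle, certified by nonnegative Bernstein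
    coefficients. *)
Require Import Defs.
From Stdlib Require Import Reals ZArith Lra Lia List.
From Coquelicot Require Import Coquelicot.
Open Scope R_scope.

(** * Regularity and symmetry of the curve, and its density as a function of u *)

Definition speed2 (K A u : R) : R :=
  A * (1 - u) / (1 - A * u) + (2 * K + 1) / (6 * (K + 1)) * (1 - A * u).

Definition sinsq (k : nat) (theta : R) : R := sin (INR (k + 1) * theta) ^ 2.

Definition integrand (k : nat) (A theta : R) : R :=
  (/ (2 * INR k + 1) - A * sinsq k theta)
  * sqrt (speed2 (INR k) A (sinsq k theta)).

Definition balance (k : nat) (A : R) : R := RInt (integrand k A) 0 (2 * PI).

Lemma one_sub_mul_pos A u : A < 1 -> 0 <= u <= 1 -> 0 < 1 - A * u.
Proof. intros HA Hu. destruct (Req_dec u 1) as [->|]; [lra | nra]. Qed.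

Lemma sinsq_range k theta : 0 <= sinsq k theta <= 1.
Proof.
  unfold sinsq. pose proof (SIN_bound (INR (k + 1) * theta)). nra.
Qed.

(** Serves the density, where [B] is the common x'^2 and [D] the common x^2, and the sphere
    identity, with [D = 0]. *)
Lemma sum_squares (B D : R) (k : nat) :
  sum_n_m (fun l : nat => B + INR l ^ 2 * D) 1 k
  = INR k * B + D * (INR k * (INR k + 1) * (2 * INR k + 1) / 6).
Proof.
  induction k as [|k IH].
  - rewrite sum_n_m_zero by lia. simpl. unfold zero; simpl. field.
  - rewrite sum_n_Sm by lia. rewrite IH. unfold plus; simpl plus.
    rewrite S_INR. simpl. field.
Qed.

Lemma zfun_lt1 k a theta : 0 < a < 1 -> 0 < 1 - zfun k a theta ^ 2.
Proof.
  intros Ha. unfold zfun. pose proof (sinsq_range k theta) as H.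
  unfold sinsq in H. set (s := sin _) in *.
  replace ((a * s) ^ 2) with (a * a * s ^ 2) by ring. nra.
Qed.

Lemma is_derive_zfun k a theta :
  is_derive (zfun k a) theta (a * (INR (k + 1) * cos (INR (k + 1) * theta))).
Proof. unfold zfun. auto_derive; [easy | ring]. Qed.

(** Implicit differentiation of k x^2 + z^2 = 1: x' = - z z' / (k x). *)
Definition dxfun (k : nat) (a theta : R) : R :=
  - (zfun k a theta * (a * (INR (k + 1) * cos (INR (k + 1) * theta))))
  / (INR k * sqrt ((1 - zfun k a theta ^ 2) / INR k)).

Lemma xfun_arg_pos k a theta : (1 <= k)%nat -> 0 < a < 1 ->
  0 < (1 - zfun k a theta ^ 2) / INR k.
Proof.
  intros Hk Ha. apply Rdiv_lt_0_compat. now apply zfun_lt1.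
  apply lt_0_INR; lia.
Qed.

Lemma is_derive_xfun k a j theta : (1 <= k)%nat -> 0 < a < 1 ->
  is_derive (xfun k a j) theta (dxfun k a theta).
Proof.
  intros Hk Ha. pose proof (xfun_arg_pos k a theta Hk Ha) as Hp.
  pose proof (lt_0_INR k ltac:(lia)) as HK.
  pose proof (sqrt_lt_R0 _ Hp) as Hs.
  apply is_derive_ext_loc with (fun t => sqrt ((1 - zfun k a t ^ 2) / INR k)).
  { now apply filter_forall. }
  evar_last.
  { apply (is_derive_sqrt (fun t => (1 - zfun k a t ^ 2) / INR k)
      theta (- (2 * zfun k a theta
                * (a * (INR (k + 1) * cos (INR (k + 1) * theta)))) / INR k)).
    - unfold zfun. auto_derive; [easy | field; lra].
    - exact Hp. }
  unfold dxfun. field. split; apply Rgt_not_eq; assumption.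
Qed.

Lemma C1_of (f g : R -> R) :
  (forall x, is_derive f x (g x)) -> (forall x, ex_derive g x) -> Defs.C1 f.
Proof.
  intros Hf Hg x. split.
  - now exists (g x).
  - apply continuous_ext with g.
    + intros y. symmetry. now apply is_derive_unique.
    + now apply (ex_derive_continuous g).
Qed.

Lemma C1_zfun k a : Defs.C1 (zfun k a).
Proof.
  apply C1_of with (1 := is_derive_zfun k a).
  intros x. auto_derive. easy.
Qed.

Lemma C1_xfun k a j : (1 <= k)%nat -> 0 < a < 1 -> Defs.C1 (xfun k a j).
Proof.
  intros Hk Ha. apply C1_of with (dxfun k a).
  - intros x. now apply is_derive_xfun.
  - intros x. pose proof (xfun_arg_pos k a x Hk Ha) as Hp.
    pose proof (lt_0_INR k ltac:(lia)) as HK.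
    pose proof (sqrt_lt_R0 _ Hp) as Hs.
    unfold dxfun, zfun in *. auto_derive. repeat split; trivial.
    apply Rgt_not_eq. now apply Rmult_lt_0_compat.
Qed.

Lemma shift_phase k theta :
  INR (k + 1) * (theta + PI / INR (k + 1)) = INR (k + 1) * theta + PI.
Proof. field. apply not_0_INR. lia. Qed.

Lemma zfun_antiperiodic k a : antiperiodic (PI / INR (k + 1)) (zfun k a).
Proof.
  intros x. unfold zfun. rewrite shift_phase, neg_sin. ring.
Qed.

Lemma xfun_periodic k a j : periodic (PI / INR (k + 1)) (xfun k a j).
Proof.
  intros x. unfold xfun. rewrite (zfun_antiperiodic k a x).
  do 2 f_equal. ring.
Qed.

Lemma sphere k a theta : (1 <= k)%nat -> 0 < a < 1 ->
  sum_n_m (fun j : nat => xfun k a j theta ^ 2) 1 k + zfun k a theta ^ 2 = 1.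
Proof.
  intros Hk Ha.
  pose proof (xfun_arg_pos k a theta Hk Ha) as Hp.
  pose proof (lt_0_INR k ltac:(lia)) as HK.
  rewrite (sum_n_m_ext _ (fun l => (1 - zfun k a theta ^ 2) / INR k + INR l ^ 2 * 0)).
  2:{ intros l. unfold xfun. rewrite pow2_sqrt by lra.
      match goal with |- @eq _ ?x ?y => change (@eq R x y) end. ring. }
  rewrite sum_squares. field. lra.
Qed.

(** The k equal terms x'^2 sum to z^2 z'^2 / (1 - z^2); adding z'^2 gives z'^2 / (1 - z^2) = (k+1)^2
    A (1-u) / (1 - A u). The terms l^2 x^2 sum to (k+1)(2k+1)(1 - A u) / 6. The factor (k+1)^2
    leaves the root. *)
Lemma density_eq k a theta : (1 <= k)%nat -> 0 < a < 1 ->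
  density k (xfun k a) (zfun k a) theta
  = INR (k + 1) * sqrt (speed2 (INR k) (a ^ 2) (sinsq k theta)).
Proof.
  intros Hk Ha.
  pose proof (xfun_arg_pos k a theta Hk Ha) as Hp.
  pose proof (zfun_lt1 k a theta Ha) as Hz.
  pose proof (lt_0_INR k ltac:(lia)) as HK.
  unfold density.
  rewrite (sum_n_m_ext _ (fun l => dxfun k a theta ^ 2
     + INR l ^ 2 * ((1 - zfun k a theta ^ 2) / INR k))).
  2:{ intros l. rewrite (is_derive_unique _ _ _ (is_derive_xfun k a l theta Hk Ha)).
      unfold xfun at 1. now rewrite pow2_sqrt by lra. }
  rewrite sum_squares, (is_derive_unique _ _ _ (is_derive_zfun k a theta)).
  rewrite <- (sqrt_pow2 (INR (k + 1))) at 3 by apply pos_INR.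
  rewrite <- sqrt_mult_alt by apply pow2_ge_0.
  f_equal. unfold dxfun, speed2.
  unfold Rdiv at 1. rewrite Rpow_mult_distr, pow_inv, Rpow_mult_distr, pow2_sqrt by lra.
  unfold sinsq, zfun in *. rewrite plus_INR in *. simpl (INR 1) in *.
  pose proof (sin2_cos2 ((INR k + 1) * theta)) as Hsc. unfold Rsqr in Hsc.
  set (s := sin _) in *. set (c := cos _) in *.
  replace (1 - s ^ 2) with (c ^ 2) by (rewrite <- Hsc; ring).
  field. repeat split; lra.
Qed.

(** * Continuity of [balance] in A, and solutions from its zeros *)

Lemma continuity_2d_integrand k A theta : A < 1 ->
  continuity_2d_pt (integrand k) A theta.
Proof.
  intros HA.
  assert (Hs : continuity_2d_pt (fun _ t => sinsq k t) A theta).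
  { apply (continuity_1d_2d_pt_comp (sinsq k) (fun _ t => t)).
    - apply continuity_pt_filterlim. apply (ex_derive_continuous (sinsq k)).
      unfold sinsq. auto_derive. easy.
    - apply continuity_2d_pt_id2. }
  assert (HAs : continuity_2d_pt (fun A t => A * sinsq k t) A theta).
  { apply continuity_2d_pt_mult; [apply continuity_2d_pt_id1 | exact Hs]. }
  apply continuity_2d_pt_mult.
  - apply continuity_2d_pt_minus; [apply continuity_2d_pt_const | exact HAs].
  - apply (continuity_1d_2d_pt_comp sqrt).
    + apply continuity_pt_filterlim, continuous_sqrt.
    + unfold speed2. apply continuity_2d_pt_plus.
      * apply continuity_2d_pt_mult.
        { apply continuity_2d_pt_mult; [apply continuity_2d_pt_id1|].
          apply continuity_2d_pt_minus; [apply continuity_2d_pt_const | exact Hs]. }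
        apply continuity_2d_pt_inv.
        { apply continuity_2d_pt_minus; [apply continuity_2d_pt_const | exact HAs]. }
        pose proof (one_sub_mul_pos A (sinsq k theta) HA (sinsq_range k theta)). lra.
      * apply continuity_2d_pt_mult; [apply continuity_2d_pt_const|].
        apply continuity_2d_pt_minus; [apply continuity_2d_pt_const | exact HAs].
Qed.

Lemma ex_RInt_integrand k A : A < 1 ->
  ex_RInt (integrand k A) 0 (2 * PI).
Proof.
  intros HA. apply (ex_RInt_continuous (V := R_CompleteNormedModule)).
  intros t _. apply continuity_pt_filterlim.
  intros eps Heps.
  destruct (continuity_2d_integrand k A t HA (mkposreal eps Heps)) as [d Hd].
  exists d. split; [apply cond_pos|].
  intros x [_ Hx]. apply Hd; [|exact Hx].
  rewrite Rminus_diag, Rabs_R0. apply cond_pos.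
Qed.

(** The integrand is uniformly continuous on a compact rectangle whose A-side contains A and stays
    below 1. A variation below eps / (4 pi) changes the integral by at most eps / 2. *)
Lemma balance_continuous k A : A < 1 -> continuity_pt (balance k) A.
Proof.
  intros HA eps Heps.
  pose proof PI_RGT_0 as HPI.
  assert (He : 0 < eps / (4 * PI)) by (apply Rdiv_lt_0_compat; lra).
  destruct (uniform_continuity_2d _ (2 * A - 1) ((1 + A) / 2) 0 (2 * PI)
    (fun x y Hx _ => continuity_2d_integrand k x y ltac:(lra)) (mkposreal _ He)) as [d Hd].
  exists (Rmin d ((1 - A) / 2)).
  split; [apply Rmin_pos; [apply cond_pos | lra]|].
  intros B [_ HB]. simpl in B, HB. unfold R_dist in HB.
  pose proof (Rmin_l d ((1 - A) / 2)). pose proof (Rmin_r d ((1 - A) / 2)).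
  pose proof (Rabs_def2 (B - A) ((1 - A) / 2) ltac:(lra)).
  assert (HBA : 2 * A - 1 <= B <= (1 + A) / 2) by lra.
  simpl. unfold R_dist.
  change (Rabs (minus (RInt (integrand k B) 0 (2 * PI))
                      (RInt (integrand k A) 0 (2 * PI))) < eps).
  rewrite <- RInt_minus by (apply ex_RInt_integrand; lra).
  eapply Rle_lt_trans.
  - apply (abs_RInt_le_const _ 0 (2 * PI) (eps / (4 * PI))); [lra| |].
    + apply (ex_RInt_minus (V := R_NormedModule)); apply ex_RInt_integrand; lra.
    + intros t Ht. left. apply Hd; try lra.
      rewrite Rminus_diag, Rabs_R0. apply cond_pos.
  - replace ((2 * PI - 0) * (eps / (4 * PI))) with (eps / 2) by (field; lra). lra.
Qed.

(** Since x_j^2 = (1 - A u) / k, the factor x_j^2 - 2/(2k+1) equals (1/(2k+1) - A u) / k. With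
    [density_eq], the integrand of (iii) is (k+1)/k times [integrand]. *)
Lemma curve_of_balance k a : (1 <= k)%nat -> 0 < a < 1 ->
  balance k (a ^ 2) = 0 -> curve_conditions k (xfun k a) (zfun k a).
Proof.
  intros Hk Ha H0.
  pose proof (lt_0_INR k ltac:(lia)) as HK.
  split; [|split].
  - split; [|split].
    + intros j _. split; [now apply C1_xfun | apply xfun_periodic].
    + apply C1_zfun.
    + apply zfun_antiperiodic.
  - intros theta. now apply sphere.
  - intros j _.
    assert (Ha2 : a ^ 2 < 1) by (simpl; nra).
    pose proof (RInt_correct _ _ _ (ex_RInt_integrand k (a ^ 2) Ha2)) as HI.
    fold (balance k (a ^ 2)) in HI. rewrite H0 in HI.
    apply (is_RInt_scal _ _ _ (INR (k + 1) / INR k)) in HI.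
    change (is_RInt (fun t => INR (k + 1) / INR k * integrand k (a ^ 2) t)
      0 (2 * PI) (INR (k + 1) / INR k * 0)) in HI.
    rewrite Rmult_0_r in HI.
    eapply is_RInt_ext, HI.
    intros t _. cbv beta. rewrite density_eq by assumption.
    pose proof (xfun_arg_pos k a t Hk Ha) as Hp.
    unfold xfun at 1. rewrite pow2_sqrt by lra.
    unfold integrand, sinsq, zfun. rewrite Rpow_mult_distr.
    match goal with |- @eq _ ?x ?y => change (@eq R x y) end. field. lra.
Qed.

Lemma solution_between k A0 A1 : (1 <= k)%nat -> 0 < A0 < A1 -> A1 < 1 ->
  0 < balance k A0 -> balance k A1 < 0 ->
  exists a, 0 < a < 1 /\ curve_conditions k (xfun k a) (zfun k a)
            /\ A0 < a ^ 2 < A1.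
Proof.
  intros Hk H0 H1 Hpos Hneg.
  destruct (Ranalysis5.IVT_interv (fun A => - balance k A) A0 A1) as [A [HA Hz]].
  - intros A HA. apply continuity_pt_opp, balance_continuous. lra.
  - lra.
  - lra.
  - lra.
  - assert (HA0 : A <> A0) by (intros ->; lra).
    assert (HA1 : A <> A1) by (intros ->; lra).
    assert (Hsq : sqrt A ^ 2 = A) by (apply pow2_sqrt; lra).
    assert (Ha : 0 < sqrt A < 1).
    { split; [apply sqrt_lt_R0; lra|].
      rewrite <- sqrt_1. apply sqrt_lt_1; lra. }
    exists (sqrt A). split; [exact Ha|]. split.
    + apply curve_of_balance; [exact Hk | exact Ha |]. rewrite Hsq. lra.
    + rewrite Hsq. lra.
Qed.

(** * Moments of u and a sign criterion for [balance] *)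

(* The form sum_i p_i x^i y^(n-i), where n + 1 is the length of [p]; [y = 1]
   evaluates the polynomial, [y = 1 - x] a Bernstein expansion. *)
Fixpoint hom (p : list R) (x y : R) : R :=
  match p with
  | nil => 0
  | a :: q => a * y ^ length q + x * hom q x y
  end.

(* The mean of u^i p(u) over a period, divided by the mean of u^i. *)
Fixpoint moment (i : nat) (p : list R) : R :=
  match p with
  | nil => 0
  | a :: q => a + INR (2 * i + 1) / INR (2 * i + 2) * moment (S i) q
  end.

(** The integral of sin^(2i) over [0, 2 pi], by Wallis's recursion. *)
Fixpoint wallis (i : nat) : R :=
  match i with
  | O => 2 * PI
  | S j => INR (2 * j + 1) / INR (2 * j + 2) * wallis j
  end.

(** Eliminating cos^2 leaves only powers of the sine; the integral of this derivative over full
    periods is zero, which is Wallis's recursion. *)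
Lemma is_derive_sin_pow_cos N n t :
  is_derive (fun t => sin (N * t) ^ S n * cos (N * t)) t
    (N * (INR (S n) * sin (N * t) ^ n - INR (S (S n)) * sin (N * t) ^ S (S n))).
Proof.
  pose proof (sin2_cos2 (N * t)) as Hsc. unfold Rsqr in Hsc.
  evar_last.
  { apply (is_derive_mult (fun t => sin (N * t) ^ S n) (fun t => cos (N * t)) t
      (INR (S n) * (N * cos (N * t)) * sin (N * t) ^ n) (N * - sin (N * t))).
    - apply (is_derive_pow (fun t => sin (N * t)) (S n)).
      auto_derive; [easy | ring].
    - auto_derive; [easy | ring].
    - intros; apply Rmult_comm. }
  rewrite !S_INR. unfold plus, mult; simpl.
  set (s := sin _) in *. set (c := cos _) in *. set (z := s ^ n).
  match goal with |- @eq _ ?x ?y => change (@eq R x y) end.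
  transitivity (N * ((INR n + 1) * ((c * c) * z) - s * (s * z))); [ring|].
  replace (c * c) with (1 - s * s) by lra. ring.
Qed.

Lemma is_RInt_sinsq_pow k i :
  is_RInt (fun t => sinsq k t ^ i) 0 (2 * PI) (wallis i).
Proof.
  induction i as [|i IH].
  - apply (is_RInt_ext (fun _ => 1)); [easy|].
    evar_last; [apply (is_RInt_const (V := R_NormedModule))|].
    unfold scal; simpl; unfold mult; simpl. ring.
  - assert (HN : INR (k + 1) <> 0) by (apply not_0_INR; lia).
    assert (H2 : INR (2 * i + 2) <> 0) by (apply not_0_INR; lia).
    set (F t := sin (INR (k + 1) * t) ^ S (2 * i) * cos (INR (k + 1) * t)).
    set (G t := INR (k + 1) * (INR (2 * i + 1) * sinsq k t ^ i
                               - INR (2 * i + 2) * sinsq k t ^ S i)).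
    assert (HD : forall t, is_derive F t (G t)).
    { intros t. unfold G, sinsq. rewrite <- !pow_mult.
      replace (2 * i + 1)%nat with (S (2 * i)) by lia.
      replace (2 * i + 2)%nat with (S (S (2 * i))) by lia.
      replace (2 * S i)%nat with (S (S (2 * i))) by lia.
      apply is_derive_sin_pow_cos. }
    assert (HI : is_RInt G 0 (2 * PI) 0).
    { evar_last.
      - apply (is_RInt_derive (V := R_CompleteNormedModule) F).
        + intros t _. apply HD.
        + intros t _. apply (ex_derive_continuous G).
          unfold G, sinsq. auto_derive. easy.
      - unfold F. replace (INR (k + 1) * (2 * PI)) with (0 + 2 * INR (k + 1) * PI) by ring.
        rewrite sin_period, Rmult_0_r, sin_0.
        rewrite pow_i by lia. unfold minus, plus, opp; simpl. ring. }
    (* u^(i+1) is (2i+1)/(2i+2) u^i minus a multiple of [G], whose integral is 0. *)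
    pose proof (is_RInt_minus _ _ _ _ _ _
      (is_RInt_scal _ _ _ (INR (2 * i + 1) / INR (2 * i + 2)) _ IH)
      (is_RInt_scal _ _ _ (/ (INR (2 * i + 2) * INR (k + 1))) _ HI)) as HS.
    eapply is_RInt_ext; [|evar_last; [exact HS|]].
    + intros t _. unfold G, minus, scal, plus, opp; simpl; unfold mult; simpl.
      match goal with |- @eq _ ?x ?y => change (@eq R x y) end.
      field. now split.
    + unfold minus, scal, plus, opp; simpl; unfold mult; simpl. ring.
Qed.

(** Peeling off the first coefficient turns u^i p into a u^i + u^(i+1) q, so the induction on [p]
    ranges over all i. *)
Lemma is_RInt_moment k p : forall i,
  is_RInt (fun t => sinsq k t ^ i * hom p (sinsq k t) 1) 0 (2 * PI)
    (wallis i * moment i p).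
Proof.
  induction p as [|a q IH]; intros i.
  - apply (is_RInt_ext (fun _ => 0)).
    { intros t _. simpl. ring. }
    evar_last; [apply (is_RInt_const (V := R_NormedModule))|].
    unfold scal; simpl; unfold mult; simpl. ring.
  - pose proof (is_RInt_plus _ _ _ _ _ _
      (is_RInt_scal _ _ _ a _ (is_RInt_sinsq_pow k i)) (IH (S i))) as HS.
    eapply is_RInt_ext; [|evar_last; [exact HS|]].
    + intros t _. unfold plus, scal; simpl; unfold mult; simpl.
      rewrite pow1.
      match goal with |- @eq _ ?x ?y => change (@eq R x y) end. ring.
    + unfold plus, scal; simpl; unfold mult; simpl. ring.
Qed.

(** With m = 1/(2k+1), the weight m - A u lies in [m - A, m], and 2 m <= A bounds its modulus by A -
    m. The list [0 :: p] stands for u p(u). The scale [lam] is 10^6 for k = 1 and sqrt 3 for k >=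
    2. *)
Lemma balance_approx k A lam p d :
  2 * / (2 * INR k + 1) <= A < 1 ->
  (forall u, 0 <= u <= 1 ->
     Rabs (lam * sqrt (speed2 (INR k) A u) - hom p u 1) <= d) ->
  Rabs (lam * balance k A
        - 2 * PI * (/ (2 * INR k + 1) * moment 0 p - A * moment 0 (0 :: p)))
  <= 2 * PI * ((A - / (2 * INR k + 1)) * d).
Proof.
  intros HA Hd. pose proof PI_RGT_0 as HPI.
  assert (Hm : 0 < / (2 * INR k + 1)).
  { apply Rinv_0_lt_compat. pose proof (pos_INR k). lra. }
  set (m := / (2 * INR k + 1)) in *.
  pose proof (RInt_correct _ _ _ (ex_RInt_integrand k A (proj2 HA))) as HJ.
  pose proof (is_RInt_minus _ _ _ _ _ _ (is_RInt_scal _ _ _ lam _ HJ)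
    (is_RInt_minus _ _ _ _ _ _ (is_RInt_scal _ _ _ m _ (is_RInt_moment k p 0))
     (is_RInt_scal _ _ _ A _ (is_RInt_moment k (0 :: p) 0)))) as HS.
  apply is_RInt_unique in HS as HU.
  match type of HU with _ = ?v => replace (_ - _) with v end.
  2:{ unfold minus, scal, plus, opp; simpl; unfold mult; simpl.
      fold (balance k A). ring. }
  rewrite <- HU. rewrite <- (Rminus_0_r (2 * PI)) at 2.
  apply abs_RInt_le_const; [lra | eexists; exact HS |].
  intros t _. unfold minus, scal, plus, opp; simpl; unfold mult; simpl.
  pose proof (sinsq_range k t) as Hu. unfold integrand. fold m.
  set (u := sinsq k t) in *.
  replace (_ + _) with ((m - A * u) * (lam * sqrt (speed2 (INR k) A u) - hom p u 1)) by ring.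
  rewrite Rabs_mult. apply Rmult_le_compat; try apply Rabs_pos.
  - apply Rabs_le. split; nra.
  - now apply Hd.
Qed.

(** The common factor 2 pi cancels, so the last hypothesis is free of pi. *)
Lemma balance_pos k A lam p d :
  0 < lam -> 2 * / (2 * INR k + 1) <= A < 1 ->
  (forall u, 0 <= u <= 1 ->
     Rabs (lam * sqrt (speed2 (INR k) A u) - hom p u 1) <= d) ->
  (A - / (2 * INR k + 1)) * d
    < / (2 * INR k + 1) * moment 0 p - A * moment 0 (0 :: p) ->
  0 < balance k A.
Proof.
  intros Hl HA Hd H. pose proof PI_RGT_0 as HPI.
  pose proof (balance_approx k A lam p d HA Hd) as HB.
  apply Rabs_le_between in HB.
  apply Rmult_lt_reg_l with lam; [exact Hl|]. rewrite Rmult_0_r.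
  apply (Rmult_lt_compat_l (2 * PI)) in H; lra.
Qed.

Lemma balance_neg k A lam p d :
  0 < lam -> 2 * / (2 * INR k + 1) <= A < 1 ->
  (forall u, 0 <= u <= 1 ->
     Rabs (lam * sqrt (speed2 (INR k) A u) - hom p u 1) <= d) ->
  (A - / (2 * INR k + 1)) * d
    < - (/ (2 * INR k + 1) * moment 0 p - A * moment 0 (0 :: p)) ->
  balance k A < 0.
Proof.
  intros Hl HA Hd H. pose proof PI_RGT_0 as HPI.
  pose proof (balance_approx k A lam p d HA Hd) as HB.
  apply Rabs_le_between in HB.
  apply Rmult_lt_reg_l with lam; [exact Hl|]. rewrite Rmult_0_r.
  apply (Rmult_lt_compat_l (2 * PI)) in H; lra.
Qed.

(** The lower bound comes from p - d <= |p - d| <= sqrt L, the upper one from sqrt L <= |p + d| = p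
    + d. *)
Lemma sqrt_approx L p d :
  0 <= p + d -> (p - d) ^ 2 <= L <= (p + d) ^ 2 -> Rabs (sqrt L - p) <= d.
Proof.
  intros Hp [H1 H2]. apply Rabs_le.
  apply sqrt_le_1_alt in H1. apply sqrt_le_1_alt in H2.
  rewrite (sqrt_pow2 (p + d)) in H2 by exact Hp.
  replace ((p - d) ^ 2) with (Rsqr (p - d)) in H1 by (unfold Rsqr; ring).
  rewrite sqrt_Rsqr_abs in H1. pose proof (Rle_abs (p - d)). lra.
Qed.

(** * Forms with integer coefficients and a computable nonnegativity test *)

Definition zhom (p : list Z) (x y : R) : R := hom (map IZR p) x y.

Lemma hom_nonneg p x y : 0 <= x -> 0 <= y ->
  List.Forall (fun a => 0 <= a) p -> 0 <= hom p x y.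
Proof.
  intros Hx Hy H. induction H as [|a q Ha _ IH]; simpl; [lra|].
  pose proof (pow_le y (length q) Hy). nra.
Qed.

Lemma zhom_nonneg p x y : 0 <= x -> 0 <= y ->
  forallb (Z.leb 0) p = true -> 0 <= zhom p x y.
Proof.
  intros Hx Hy H. apply hom_nonneg; [exact Hx | exact Hy|].
  apply Forall_map, Forall_forall. intros a Ha.
  apply IZR_le, Z.leb_le. now apply (proj1 (forallb_forall _ _) H).
Qed.

(** Coefficients are aligned at the constant term. For equal lengths this adds forms ([zhom_padd]),
    in general only their values at y = 1 ([zhom_padd1]). *)
Fixpoint padd (p q : list Z) : list Z :=
  match p, q with
  | nil, _ => q
  | _, nil => p
  | a :: p', b :: q' => (a + b)%Z :: padd p' q'
  end.

Definition pscale (c : Z) (p : list Z) : list Z := map (Z.mul c) p.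

Fixpoint pmul (p q : list Z) : list Z :=
  match p with
  | nil => nil
  | a :: p' => padd (pscale a q) (0%Z :: pmul p' q)
  end.

Lemma zhom_cons a p x y :
  zhom (a :: p) x y = IZR a * y ^ length p + x * zhom p x y.
Proof. unfold zhom. simpl. now rewrite length_map. Qed.

Lemma length_padd p : forall q, length p = length q -> length (padd p q) = length q.
Proof.
  induction p as [|a p IH]; intros [|b q]; simpl; intros H; try easy.
  now rewrite IH by lia.
Qed.

Lemma zhom_padd p : forall q x y, length p = length q ->
  zhom (padd p q) x y = zhom p x y + zhom q x y.
Proof.
  induction p as [|a p IH]; intros [|b q] x y H; try easy.
  - unfold zhom; simpl. ring.
  - simpl in H. simpl padd. rewrite !zhom_cons, IH, length_padd, plus_IZR by lia.
    replace (length p) with (length q) by lia. ring.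
Qed.

Lemma zhom_padd1 p : forall q x, zhom (padd p q) x 1 = zhom p x 1 + zhom q x 1.
Proof.
  induction p as [|a p IH]; intros [|b q] x;
    try (unfold zhom; simpl; ring).
  simpl padd. rewrite !zhom_cons, IH, plus_IZR, !pow1. ring.
Qed.

Lemma zhom_pscale c p x y : zhom (pscale c p) x y = IZR c * zhom p x y.
Proof.
  induction p as [|a p IH]; [unfold zhom; simpl; ring|].
  unfold pscale in *. simpl map. rewrite !zhom_cons, IH, mult_IZR, length_map. ring.
Qed.

Lemma zhom_pmul1 p q x : zhom (pmul p q) x 1 = zhom p x 1 * zhom q x 1.
Proof.
  induction p as [|a p IH]; [unfold zhom; simpl; ring|].
  simpl pmul. rewrite zhom_padd1, zhom_pscale, !zhom_cons, IH, !pow1. ring.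
Qed.

Lemma zhom_app p q x y :
  zhom (p ++ q) x y = zhom p x y * y ^ length q + x ^ length p * zhom q x y.
Proof.
  induction p as [|a p IH]; [unfold zhom; simpl; ring|].
  simpl app. rewrite !zhom_cons, IH, length_app, pow_add. simpl. ring.
Qed.

Lemma zhom_rev p x y : zhom (rev p) x y = zhom p y x.
Proof.
  induction p as [|a p IH]; [easy|].
  simpl rev. rewrite zhom_app, !zhom_cons, IH, length_rev.
  unfold zhom; simpl. ring.
Qed.

(* Horner's scheme for [hom p x (x + y)] as a form in [x] and [y]. *)
Fixpoint split_from (acc p : list Z) : list Z :=
  match p with
  | nil => acc
  | a :: q => split_from (padd (0%Z :: acc) (acc ++ a :: nil)) q
  end.

(** Each step replaces the form of [acc] by its product with x + y, plus a x^n, where n is the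
    length of [acc]. *)
Lemma zhom_split_from p : forall acc x y,
  zhom (split_from acc p) x y
  = zhom acc x y * (x + y) ^ length p + x ^ length acc * zhom p x (x + y).
Proof.
  induction p as [|a q IH]; intros acc x y; [unfold zhom; simpl; ring|].
  assert (L : length (0%Z :: acc) = length (acc ++ a :: nil))
    by (rewrite length_app; simpl; lia).
  cbn [split_from].
  rewrite IH, zhom_padd, length_padd, <- L, zhom_app, !zhom_cons by exact L.
  unfold zhom; simpl. ring.
Qed.

Definition split_low (p : list Z) : list Z := split_from nil p.

Lemma zhom_split_low p x y : zhom (split_low p) x y = zhom p x (x + y).
Proof. unfold split_low. rewrite zhom_split_from. unfold zhom; simpl. ring. Qed.

(* The quadrant is the union of {x <= y}, where (x, y) = (x, x + z), and its
   mirror image; [split_low] expresses the form in x and z. *)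
Fixpoint nonneg_check (fuel : nat) (p : list Z) : bool :=
  if forallb (Z.leb 0) p then true
  else match fuel with
       | O => false
       | S n => (nonneg_check n (split_low p) && nonneg_check n (split_low (rev p)))%bool
       end.

Lemma nonneg_check_sound fuel : forall p x y,
  nonneg_check fuel p = true -> 0 <= x -> 0 <= y -> 0 <= zhom p x y.
Proof.
  induction fuel as [|n IH]; intros p x y H Hx Hy; simpl in H;
    destruct (forallb (Z.leb 0) p) eqn:E; try easy;
    try (now apply zhom_nonneg).
  apply andb_prop in H as [H1 H2].
  destruct (Rle_dec x y) as [Hxy|Hxy].
  - replace y with (x + (y - x)) by ring. rewrite <- zhom_split_low.
    apply IH; [exact H1 | exact Hx | lra].
  - rewrite <- zhom_rev. replace x with (y + (x - y)) by ring.
    rewrite <- zhom_split_low. apply IH; [exact H2 | exact Hy | lra].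
Qed.

(** At (u, 1 - u) the form [split_low p] takes the value p(u): its entries are Bernstein
    coefficients up to binomial factors, and [nonneg_check] subdivides where some are negative. *)
Lemma nonneg_on_unit fuel p u :
  nonneg_check fuel (split_low p) = true -> 0 <= u <= 1 -> 0 <= zhom p u 1.
Proof.
  intros H Hu. replace 1 with (u + (1 - u)) by ring.
  rewrite <- zhom_split_low. apply (nonneg_check_sound fuel); [exact H | lra | lra].
Qed.

(** * The case k = 1 *)

(* [speed1 b / (4000 * weight1 b)] is [speed2 1 (b / 1000)]. *)
Definition weight1 (b : Z) : list Z := (1000%Z :: (- b)%Z :: nil).
Definition speed1 (b : Z) : list Z :=
  padd (pscale (4000 * b) (1%Z :: (-1)%Z :: nil)) (pmul (weight1 b) (weight1 b)).

(** The three checks are P + d >= 0 and, with denominators cleared, 10^12 V <= (P + d)^2 and (P -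
    d)^2 <= 10^12 V. *)
Definition cert1 (fuel : nat) (b : Z) (p : list Z) (d : Z) : bool :=
  let q s := padd p (s :: nil) in
  let sq s := pmul (pscale 4000 (weight1 b)) (pmul (q s) (q s)) in
  let v := pscale 1000000000000 (speed1 b) in
  (nonneg_check fuel (split_low (q d))
   && nonneg_check fuel (split_low (padd (sq d) (pscale (-1) v)))
   && nonneg_check fuel (split_low (padd v (pscale (-1) (sq (- d)%Z)))))%bool.

Lemma cert1_sound fuel b p d u : (0 < b < 1000)%Z -> cert1 fuel b p d = true -> 0 <= u <= 1 ->
  Rabs (1000000 * sqrt (speed2 (INR 1) (IZR b / 1000) u) - hom (map IZR p) u 1) <= IZR d.
Proof.
  intros Hb H Hu. unfold cert1 in H.
  apply andb_prop in H as [H H3]. apply andb_prop in H as [H1 H2].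
  apply (nonneg_on_unit _ _ u) in H1, H2, H3; try exact Hu.
  rewrite zhom_padd1 in H1, H2, H3.
  unfold speed1, weight1 in *.
  rewrite ?zhom_pscale, ?zhom_pmul1, ?zhom_padd1, ?zhom_pscale, ?zhom_pmul1 in H2, H3.
  rewrite ?zhom_cons, ?pow1 in *. change (zhom nil u 1) with 0 in *.
  change (hom (map IZR p) u 1) with (zhom p u 1).
  destruct Hb as [Hb0 Hb1]. apply IZR_lt in Hb0, Hb1.
  set (P := zhom p u 1) in *.
  rewrite ?opp_IZR, ?mult_IZR in *.
  set (B := IZR b) in *. set (D := IZR d) in *.
  assert (Hr : 0 < 1000 - B * u) by nra.
  replace 1000000 with (sqrt 1000000000000)
    by (replace 1000000000000 with (1000000 ^ 2) by ring; apply sqrt_pow2; lra).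
  rewrite <- sqrt_mult_alt by lra.
  set (L := 1000000000000 * speed2 (INR 1) (B / 1000) u).
  assert (HL : L * (4000 * (1000 - B * u))
    = 1000000000000 * (4000 * B * (1 - u) + (1000 - B * u) ^ 2)).
  { unfold L, speed2. simpl (INR 1). field. lra. }
apply sqrt_approx; [lra | split].
  - apply Rmult_le_reg_r with (4000 * (1000 - B * u)); [lra|].
    rewrite HL. lra.
  - apply Rmult_le_reg_r with (4000 * (1000 - B * u)); [lra|].
    rewrite HL. lra.
Qed.
(* Minimax approximations of 10^6 sqrt (speed2 1 A u), rounded to integers. *)
Definition approx820 : list Z :=
  (1034680 :: (-369318) :: 24128127 :: (-1168174918) :: 29781983948 ::
   (-463072823466) :: 4781214966676 :: (-34632240743529) :: 182625859430486
   :: (-719026616316196) :: 2149204890314934 :: (-4925462026628422) ::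
   8687673390811773 :: (-11766560117410047) :: 12123990268855745 ::
   (-9329226186403705) :: 5189539089468174 :: (-1970623715165559) ::
   456950108249958 :: (-48799484996936) :: nil)%Z.

Definition approx821 : list Z :=
  (1035170 :: (-374376) :: 24775083 :: (-1199319787) :: 30574276477 ::
   (-475364305341) :: 4907838061999 :: (-35547344229595) :: 187440475628443
   :: (-737939094653330) :: 2205604892944924 :: (-5054417352913152) ::
   8914596838051508 :: (-12073180422703786) :: 12439173949889433 ::
   (-9571173623991759) :: 5323800489288056 :: (-2021482025772550) ::
   468713993509586 :: (-50052648985183) :: nil)%Z.

Lemma balance_820 : 0 < balance 1 (820 / 1000).
Proof.
  assert (Hm : / (2 * INR 1 + 1) = 1 / 3) by (simpl; field).
  (* At scale 10^6, [355] bounds the error in sqrt V by 0.000355. *)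
  apply (balance_pos 1 _ 1000000 (map IZR approx820) 355); rewrite ?Hm; try lra.
  - intros u Hu. apply (cert1_sound 30 820); [lia | vm_compute; reflexivity | exact Hu].
  - unfold approx820. cbn [map moment].
    rewrite !INR_IZR_INZ. cbn -[IZR]. lra.
Qed.

Lemma balance_821 : balance 1 (821 / 1000) < 0.
Proof.
  assert (Hm : / (2 * INR 1 + 1) = 1 / 3) by (simpl; field).
  apply (balance_neg 1 _ 1000000 (map IZR approx821) 438); rewrite ?Hm; try lra.
  - intros u Hu. apply (cert1_sound 30 821); [lia | vm_compute; reflexivity | exact Hu].
  - unfold approx821. cbn [map moment].
    rewrite !INR_IZR_INZ. cbn -[IZR]. lra.
Qed.

(** * The case k >= 2, with h = 1/k *)

(* Bernstein coefficients in u on [0,1] and h on [0,1/2] (margins: h only), up to the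
   factors displayed in [balance_lo] and [balance_hi]; the u-degree of the two
   large [hi] tables is raised by 2 to make all coefficients nonnegative. *)
Definition cert_lo_below : list (list Z) :=
  ((1024 :: 19360 :: 160638 :: 759878 :: 2232308 :: 4158320 :: 4786560 ::
   3107808 :: 870208 :: nil) :: (5120 :: 74784 :: 479990 :: 1780544 ::
   4207370 :: 6532783 :: 6545913 :: 3879248 :: 1038612 :: nil) :: (10240 ::
   156224 :: 1034412 :: 3874532 :: 8943936 :: 12944748 :: 11363732 ::
   5463360 :: 1082640 :: nil) :: (10240 :: 178752 :: 1340204 :: 5643304 ::
   14606796 :: 23781994 :: 23726982 :: 13209376 :: 3125944 :: nil) :: (5120
   :: 91168 :: 697526 :: 2983750 :: 7792188 :: 12721436 :: 12689332 ::
   7073888 :: 1686096 :: nil) :: (1024 :: 13216 :: 72382 :: 219400 :: 401562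
   :: 451551 :: 299593 :: 102672 :: 11988 :: nil) :: nil)%Z.
Definition cert_lo_above : list (list Z) :=
  ((1024 :: 18016 :: 134722 :: 560250 :: 1417868 :: 2235024 :: 2139776 ::
   1134624 :: 254144 :: nil) :: (5120 :: 105952 :: 910794 :: 4310208 ::
   12387638 :: 22262321 :: 24519975 :: 15169200 :: 4042092 :: nil) :: (10240
   :: 192960 :: 1572052 :: 7242652 :: 20668608 :: 37470996 :: 42203628 ::
   27018944 :: 7526640 :: nil) :: (10240 :: 158144 :: 1088084 :: 4372184 ::
   11237300 :: 18931670 :: 20442682 :: 12946656 :: 3676232 :: nil) :: (5120
   :: 71136 :: 425994 :: 1458042 :: 3187524 :: 4672356 :: 4579788 :: 2772896
   :: 791472 :: nil) :: (1024 :: 18016 :: 133890 :: 553464 :: 1401766 ::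
   2242561 :: 2227671 :: 1264368 :: 316332 :: nil) :: nil)%Z.
Definition cert_lo_sum : list (list Z) :=
  ((32 :: 232 :: 535 :: 382 :: nil) :: (64 :: 400 :: 950 :: 748 :: nil) ::
   (32 :: 168 :: 303 :: 206 :: nil) :: nil)%Z.
Definition cert_lo_margin : list Z :=
   (24 :: 66 :: 30 :: 19 :: nil)%Z.

Definition cert_hi_below : list (list Z) :=
  ((2048 :: 41792 :: 359676 :: 1719628 :: 5025064 :: 9229792 :: 10439424 ::
   6664128 :: 1841792 :: nil) :: (14336 :: 230080 :: 1616356 :: 6493080 ::
   16317108 :: 26273089 :: 26473671 :: 15262912 :: 3854188 :: nil) :: (43008
   :: 620608 :: 3865132 :: 13533076 :: 29014896 :: 38750166 :: 31136458 ::
   13488016 :: 2311208 :: nil) :: (71680 :: 1044928 :: 6640884 :: 24074720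
   :: 54617500 :: 79815711 :: 73986985 :: 40267408 :: 10008116 :: nil) ::
   (71680 :: 1112512 :: 7657844 :: 30614068 :: 77968808 :: 129927828 ::
   138731340 :: 86972768 :: 24541744 :: nil) :: (43008 :: 700480 :: 5087404
   :: 21490808 :: 57672044 :: 100541167 :: 111065641 :: 71017440 :: 20112404
   :: nil) :: (14336 :: 228032 :: 1619556 :: 6693996 :: 17560384 :: 29840854
   :: 31968970 :: 19674704 :: 5308584 :: nil) :: (2048 :: 27456 :: 157564 ::
   502160 :: 962500 :: 1118673 :: 749895 :: 251856 :: 28620 :: nil) :: nil)%Z.
Definition cert_hi_above : list (list Z) :=
  ((2048 :: 32960 :: 231044 :: 923700 :: 2309080 :: 3704352 :: 3732736 ::
   2164800 :: 554368 :: nil) :: (14336 :: 280896 :: 2346652 :: 10990440 ::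
   31703244 :: 57862111 :: 65404697 :: 41937984 :: 11695124 :: nil) ::
   (43008 :: 875456 :: 7501652 :: 35760876 :: 104471696 :: 192402922 ::
   218803830 :: 140755824 :: 39262936 :: nil) :: (71680 :: 1387072 ::
   11423116 :: 52673056 :: 149362916 :: 267308481 :: 295080567 :: 183613808
   :: 49219660 :: nil) :: (71680 :: 1258048 :: 9515276 :: 40591436 ::
   106798936 :: 177047020 :: 179677748 :: 101119136 :: 23748560 :: nil) ::
   (43008 :: 684992 :: 4675796 :: 17835656 :: 41326356 :: 58758129 ::
   48599031 :: 19803424 :: 2212972 :: nil) :: (14336 :: 221504 :: 1452572 ::
   5261588 :: 11404992 :: 14836714 :: 10766966 :: 3399856 :: 34392 :: nil)
   :: (2048 :: 35008 :: 254980 :: 1038448 :: 2592188 :: 4062287 :: 3896985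
   :: 2084400 :: 472500 :: nil) :: nil)%Z.
Definition cert_hi_sum : list (list Z) :=
  ((32 :: 232 :: 535 :: 406 :: nil) :: (64 :: 400 :: 950 :: 820 :: nil) ::
   (32 :: 168 :: 303 :: 190 :: nil) :: nil)%Z.
Definition cert_hi_margin : list Z :=
   (16 :: 124 :: 358 :: 459 :: 224 :: nil)%Z.


(** The tensor Bernstein basis on [0,1/2] x [0,1], up to constant factors: on this rectangle h, 1 -
    2h, u and 1 - u are all nonnegative. *)
Definition tensor (M : list (list Z)) (h u : R) : R :=
  hom (map (fun l => zhom l h (1 - 2 * h)) M) u (1 - u).

Lemma tensor_nonneg M h u : 0 < h <= 1 / 2 -> 0 <= u <= 1 ->
  forallb (forallb (Z.leb 0)) M = true -> 0 <= tensor M h u.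
Proof.
  intros Hh Hu H. apply hom_nonneg; [lra | lra |].
  apply Forall_map, Forall_forall. intros l Hl.
  apply zhom_nonneg; [lra | lra |]. now apply (proj1 (forallb_forall _ _) H).
Qed.

(** The pure power of x keeps the value positive at y = 0, which occurs for k = 2, where 1 - 2h =
    0. *)
Lemma zhom_pos a p x y : 0 < x -> 0 <= y ->
  forallb (Z.ltb 0) (a :: p) = true -> 0 < zhom (a :: p) x y.
Proof.
  intros Hx Hy. revert a. induction p as [|b p IH]; intros a H;
    simpl in H; apply andb_prop in H as [Ha H]; apply Z.ltb_lt, IZR_lt in Ha.
  - unfold zhom; simpl. lra.
  - rewrite zhom_cons. specialize (IH b H). pose proof (pow_le y (length (b :: p)) Hy).
    nra.
Qed.

(** [numer / denom] is 3 V. As h and A tend to 0, V tends to 1/3, so the factor 3 makes the Taylor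
    coefficients of the root rational. *)
Definition numer (h A u : R) : R :=
  6 * (1 + h) * A * (1 - u) + (2 + h) * (1 - A * u) ^ 2.

Definition denom (h A u : R) : R := 2 * (1 + h) * (1 - A * u).

Lemma speed2_inv h A u : 0 < h -> 0 < 1 - A * u ->
  3 * speed2 (/ h) A u * denom h A u = numer h A u.
Proof. intros Hh Hu. unfold speed2, denom, numer. field. lra. Qed.

(** Multiplying by the positive [denom] makes both bounds on 3 V polynomial. [S] certifies P + d >=
    0, [B] the lower bound and [C] the upper one. The factor h^2 reflects that d is of order h^2 in
    the applications. *)
Lemma sqrt3_speed2_approx h A u P d S B C s b :
  0 < h <= 1 / 2 -> 0 <= u <= 1 -> A < 1 -> 0 < s -> 0 < b ->
  forallb (forallb (Z.leb 0)) S = true ->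
  forallb (forallb (Z.leb 0)) B = true ->
  forallb (forallb (Z.leb 0)) C = true ->
  P + d = tensor S h u / s ->
  numer h A u - denom h A u * (P - d) ^ 2 = h ^ 2 * (tensor B h u / b) ->
  denom h A u * (P + d) ^ 2 - numer h A u = h ^ 2 * (tensor C h u / b) ->
  Rabs (sqrt 3 * sqrt (speed2 (/ h) A u) - P) <= d.
Proof.
  intros Hh Hu HA Hs Hb HS HB HC ES EB EC.
  pose proof (one_sub_mul_pos A u HA Hu) as Hr.
  pose proof (speed2_inv h A u (proj1 Hh) Hr) as HN.
  assert (HD : 0 < denom h A u) by (unfold denom; nra).
  assert (Hsum : 0 <= P + d).
  { rewrite ES. apply Rdiv_le_0_compat; [now apply tensor_nonneg | exact Hs]. }
  assert (Hlow : 0 <= h ^ 2 * (tensor B h u / b)).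
  { apply Rmult_le_pos; [apply pow2_ge_0|].
    apply Rdiv_le_0_compat; [now apply tensor_nonneg | exact Hb]. }
  assert (Hup : 0 <= h ^ 2 * (tensor C h u / b)).
  { apply Rmult_le_pos; [apply pow2_ge_0|].
    apply Rdiv_le_0_compat; [now apply tensor_nonneg | exact Hb]. }
  rewrite <- sqrt_mult_alt by lra. set (L := 3 * speed2 _ _ _) in *.
  apply sqrt_approx; [exact Hsum | split];
    apply Rmult_le_reg_r with (denom h A u); lra.
Qed.

(* The second-order Taylor polynomial in h of sqrt (3 V) is the same for
   A = h - h^3/2 and A = h + h^3/4; the c_i are fitted numerically. *)
Definition taylor (h c0 c1 c2 : R) : list R :=
  1 + 5 / 4 * h - 17 / 32 * h ^ 2 + c0 * h ^ 3
  :: - 2 * h + 17 / 4 * h ^ 2 + c1 * h ^ 3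
  :: - 7 / 2 * h ^ 2 + c2 * h ^ 3 :: nil.

Lemma inv_INR k : (2 <= k)%nat -> 0 < / INR k <= 1 / 2.
Proof.
  intros Hk. apply le_INR in Hk. simpl in Hk. split.
  - apply Rinv_0_lt_compat. lra.
  - replace (1 / 2) with (/ 2) by field. apply Rinv_le_contravar; lra.
Qed.

Lemma balance_lo k : (2 <= k)%nat ->
  0 < balance k (/ INR k - 1 / 2 * (/ INR k) ^ 3).
Proof.
  intros Hk. pose proof (inv_INR k Hk) as Hh.
  assert (HK : INR k = / / INR k) by (rewrite Rinv_inv; easy).
  set (h := / INR k) in *. set (A := h - 1 / 2 * h ^ 3).
  assert (Hm : / (2 * INR k + 1) = h / (2 + h)) by (rewrite HK; field; lra).
  assert (HA1 : A < 1) by (unfold A; nra).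
  (* This is 2 m <= A with the denominator 2 + h cleared. *)
  assert (HA2 : 0 <= A * (2 + h) - 2 * h).
  { replace (A * (2 + h) - 2 * h) with (h ^ 2 * (1 - h - h ^ 2 / 2))
      by (unfold A; field).
    apply Rmult_le_pos; [apply pow2_ge_0 | nra]. }
  apply (balance_pos k A (sqrt 3) (taylor h (- 1 / 2) (- 1) 2) (h ^ 2 / 4)).
  - apply sqrt_lt_R0; lra.
  - rewrite Hm. split; [|exact HA1].
    apply Rmult_le_reg_r with (2 + h); [lra|].
    replace (2 * (h / (2 + h)) * (2 + h)) with (2 * h) by (field; lra). lra.
  - intros u Hu. rewrite HK.
    apply (sqrt3_speed2_approx h A u _ _ cert_lo_sum cert_lo_below
      cert_lo_above 32 1024 Hh Hu HA1); try reflexivity; try lra;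
      unfold tensor, zhom, taylor, numer, denom, A;
      cbn [cert_lo_sum cert_lo_below cert_lo_above map hom length]; field.
  (* For A = h + c h^3 the orders h and h^2 of the moment difference cancel, and h^3 has coefficient
     - 1/32 - c/2. Here c = -1/2 gives 7/32, against 1/8 from the error term. *)
  - rewrite Hm. apply Rlt_0_minus.
    match goal with |- 0 < ?x => replace x with
      (h ^ 3 * (zhom cert_lo_margin h (1 - 2 * h) / (128 * (2 + h)))) end.
    + apply Rmult_lt_0_compat; [apply pow_lt; lra|].
      apply Rdiv_lt_0_compat; [apply zhom_pos; trivial; lra | lra].
    + unfold zhom, taylor, A. cbn [cert_lo_margin map hom length moment].
      simpl INR. field. lra.
Qed.

Lemma balance_hi k : (2 <= k)%nat ->
  balance k (/ INR k + 1 / 4 * (/ INR k) ^ 3) < 0.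
Proof.
  intros Hk. pose proof (inv_INR k Hk) as Hh.
  assert (HK : INR k = / / INR k) by (rewrite Rinv_inv; easy).
  set (h := / INR k) in *. set (A := h + 1 / 4 * h ^ 3).
  assert (Hm : / (2 * INR k + 1) = h / (2 + h)) by (rewrite HK; field; lra).
  assert (HA1 : A < 1) by (unfold A; nra).
  assert (HA2 : 0 <= A * (2 + h) - 2 * h).
  { replace (A * (2 + h) - 2 * h) with (h ^ 2 * (1 + h / 2 + h ^ 2 / 4))
      by (unfold A; field).
    apply Rmult_le_pos; [apply pow2_ge_0 | nra]. }
  apply (balance_neg k A (sqrt 3) (taylor h (1 / 4) (- 1 / 4) 0) (h ^ 2 / 4)).
  - apply sqrt_lt_R0; lra.
  - rewrite Hm. split; [|exact HA1].
    apply Rmult_le_reg_r with (2 + h); [lra|].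
    replace (2 * (h / (2 + h)) * (2 + h)) with (2 * h) by (field; lra). lra.
  - intros u Hu. rewrite HK.
    apply (sqrt3_speed2_approx h A u _ _ cert_hi_sum cert_hi_below
      cert_hi_above 32 2048 Hh Hu HA1); try reflexivity; try lra;
      unfold tensor, zhom, taylor, numer, denom, A;
      cbn [cert_hi_sum cert_hi_below cert_hi_above map hom length]; field.
  (* Now c = 1/4 gives - 5/32, again against 1/8. *)
  - rewrite Hm. apply Rlt_0_minus.
    match goal with |- 0 < ?x => replace x with
      (h ^ 3 * (zhom cert_hi_margin h (1 - 2 * h) / (256 * (2 + h)))) end.
    + apply Rmult_lt_0_compat; [apply pow_lt; lra|].
      apply Rdiv_lt_0_compat; [apply zhom_pos; trivial; lra | lra].
    + unfold zhom, taylor, A. cbn [cert_hi_margin map hom length moment].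
      simpl INR. field. lra.
Qed.

(** * Existence of a_k in the stated ranges *)

Lemma solution_ge2 k : (2 <= k)%nat ->
  exists a : R,
    0 < a < 1 /\ curve_conditions k (xfun k a) (zfun k a)
    /\ 1 / INR k - 1 / (2 * INR k ^ 3) < a ^ 2 < 1 / INR k + 1 / (4 * INR k ^ 3).
Proof.
  intros Hk. pose proof (inv_INR k Hk) as Hh.
  assert (HK : INR k <> 0) by (apply not_0_INR; lia).
  replace (1 / INR k - 1 / (2 * INR k ^ 3))
    with (/ INR k - 1 / 2 * (/ INR k) ^ 3) by (field; exact HK).
  replace (1 / INR k + 1 / (4 * INR k ^ 3))
    with (/ INR k + 1 / 4 * (/ INR k) ^ 3) by (field; exact HK).
  apply solution_between; [lia | | | now apply balance_lo | now apply balance_hi];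
    set (h := / INR k) in *;
    (* h <= 1/2 gives h^3 <= h/4, after which the conditions on the endpoints are linear. *)
    assert (0 < h ^ 3 <= h / 4) by (split; [apply pow_lt; lra | nra]); lra.
Qed.

Theorem theorem9 :
  (forall k : nat, (1 <= k)%nat ->
     exists a : R, 0 < a < 1 /\ curve_conditions k (xfun k a) (zfun k a))
  /\ (exists a : R,
        0 < a < 1 /\ curve_conditions 1 (xfun 1 a) (zfun 1 a)
        /\ 820 / 1000 < a ^ 2 < 821 / 1000)
  /\ (forall k : nat, (2 <= k)%nat ->
        exists a : R,
          0 < a < 1 /\ curve_conditions k (xfun k a) (zfun k a)
          /\ 1 / INR k - 1 / (2 * INR k ^ 3) < a ^ 2
               < 1 / INR k + 1 / (4 * INR k ^ 3)).
Proof.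
  assert (H1 : exists a : R,
        0 < a < 1 /\ curve_conditions 1 (xfun 1 a) (zfun 1 a)
        /\ 820 / 1000 < a ^ 2 < 821 / 1000).
  { apply solution_between; [lia | lra | lra | exact balance_820 | exact balance_821]. }
  split; [|split].
  - intros k Hk. destruct (Nat.eq_dec k 1) as [->|Hk1].
    + destruct H1 as [a [Ha [Hc _]]]. now exists a.
    + destruct (solution_ge2 k ltac:(lia)) as [a [Ha [Hc _]]]. now exists a.
  - exact H1.
  - exact solution_ge2.
Qed.
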